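(* Let $B=(V,E)$ be a finite bipartite multigraph with at least one edge, and let $t\in\mathbb{N}$. Then $$\chi^t(B)\,=\,\chi'(B)+2t\,=\,\Delta(B)+2t.$$
   Context: $\mathbb{N}=\{0,1,2,\dots\}$, $\mathbb{Z}^+=\{1,2,\dots\}$, and $\mathcal{P}(\mathbb{Z}^+)$ is the power set of $\mathbb{Z}^+$. A multigraph may have several parallel edges between two vertices, but every edge $uv=\{u,v\}$ has two distinct ends. $\Delta(B)$ is the maximal degree (edges counted with multiplicity). An edge coloring is a map $c'\colon E\to\{1,\dots,m\}$ with $c'(e)\neq c'(f)$ for any two distinct edges $e,f$ sharing at least one end; $\chi'(B)$ (chromatic index) is the smallest $m\in\mathbb{Z}^+$ for which such a map exists. For a multi-labeling $c\colon V\to\mathcal{P}(\mathbb{Z}^+)$, an edge coloring $c'$ avoids $c$ if $c'(e)\notin\bigcup_{v\in e}c(v)$ for every $e\in E$. The $c$-avoiding chromatic index $\chi'_c(B)$ is the smallest $m\in\mathbb{Z}^+$ for which there is an edge coloring $c'\colon E\to\{1,\dots,m\}$ that avoids $c$. A $t$-labeling is a multi-labeling $c$ with $|c(v)|\le t$ for all $v\in V$. The $t$-avoiding chromatic index is $\chi^t(B):=\max\{\chi'_c(B) : c \text{ is a } t\text{-labeling}\}$. *)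

(* Defs.v *)
From mathcomp Require Import all_boot all_order.
From mathcomp Require Import boolp classical_sets functions cardinality.

Set Implicit Arguments.
Unset Strict Implicit.
Unset Printing Implicit Defensive.

Local Open Scope classical_set_scope.
Local Open Scope card_scope.

(* Least and greatest elements of a set of naturals; the value 0 signals that
   there is none (below, only sets of positive naturals are used). *)
Definition nat_min (A : set nat) : nat := xget 0 (A `&` lbound A).
Definition nat_max (A : set nat) : nat := xget 0 (A `&` ubound A).

Record multigraph := Multigraph {
  vertex : finType;
  edge : finType;
  ends : edge -> {set vertex};
  card_ends : forall e, #|ends e| = 2 }.

Definition bipartite (B : multigraph) : Prop :=
  exists X Y : {set vertex B},
    [/\ X :|: Y = [set: vertex B]%SET, X :&: Y = finset.set0 &
        forall e : edge B, exists x y : vertex B,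
          [/\ x \in X, y \in Y & ends e = [set x; y]%SET]].

Definition degree (B : multigraph) (v : vertex B) : nat :=
  #|[set e : edge B | v \in ends e]%SET|.

Definition max_degree (B : multigraph) : nat := \max_(v : vertex B) degree v.

(* Colors and labels are positive naturals. *)
Definition edge_coloring (B : multigraph) (m : nat) (c' : edge B -> nat) : Prop :=
  (forall e, 1 <= c' e <= m) /\
  (forall e f v, e != f -> v \in ends e -> v \in ends f -> c' e <> c' f).

Definition chromatic_index (B : multigraph) : nat :=
  nat_min [set m | 1 <= m /\ exists c' : edge B -> nat, edge_coloring m c'].

Definition multi_labeling (B : multigraph) (c : vertex B -> set nat) : Prop :=
  forall v, c v `<=` [set k | 1 <= k].

Definition avoids (B : multigraph) (c : vertex B -> set nat)
    (c' : edge B -> nat) : Prop :=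
  forall e, ~ (\bigcup_(v in [set` ends e]) c v) (c' e).

(* For a multi-labeling with infinite label sets there may be no avoiding
   coloring at all (value 0); for t-labelings there always is one, see
   [avoiding_chromatic_index_attained]. *)
Definition avoiding_chromatic_index (B : multigraph)
    (c : vertex B -> set nat) : nat :=
  nat_min [set m | 1 <= m /\
    exists c' : edge B -> nat, edge_coloring m c' /\ avoids c c'].

Definition t_labeling (B : multigraph) (t : nat) (c : vertex B -> set nat) : Prop :=
  multi_labeling c /\ forall v, c v #<= `I_t.

Definition t_avoiding_chromatic_index (B : multigraph) (t : nat) : nat :=
  nat_max [set avoiding_chromatic_index c |
    c in [set c : vertex B -> set nat | t_labeling t c]].

Lemma nat_minP (A : set nat) : A !=set0 -> A (nat_min A) /\ lbound A (nat_min A).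
Proof.
move=> [n An]; apply: (@xgetPex _ 0 (A `&` lbound A)).
have exA : exists n, `[< A n >] by exists n; apply/asboolP.
case: (ex_minnP exA) => m /asboolP Am minm; exists m; split=> // k Ak.
by rewrite leEnat; apply: minm; apply/asboolP.
Qed.

Lemma avoiding_chromatic_index_attained (B : multigraph) (t : nat)
    (c : vertex B -> set nat) (m := avoiding_chromatic_index c) :
  t_labeling t c ->
  1 <= m /\ exists c' : edge B -> nat, edge_coloring m c' /\ avoids c c'.
Proof.
move=> [_ ct].
have finc v : finite_set (c v) by apply/finite_set_leP; exists t.
have /choice[b bP] : forall v, exists b, forall k, c v k -> k <= b.
  move=> v; have /finite_fsetP[X cX] := finc v.
  exists (\max_(i <- finmap.enum_fset X) i) => k; rewrite cX => kX.
  exact: (@leq_bigmax_seq _ _ xpredT id).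
pose N := \max_v b v.
pose c' (e : edge B) := (N + enum_rank e).+1.
suff /nat_minP[] : [set m | 1 <= m /\
    exists c' : edge B -> nat, edge_coloring m c' /\ avoids c c'] !=set0 by [].
exists (N + #|edge B|).+1; split=> //; exists c'; split; first split.
- by move=> e; rewrite /c' /= ltnS leq_add2l ltnW.
- move=> e f v /eqP ef _ _ [] /addnI /val_inj /enum_rank_inj; exact: ef.
- move=> e [v _ /bP]; rewrite /c' leqNgt => /negP; apply.
  by rewrite ltnS (leq_trans _ (leq_addr _ _))// /N leq_bigmax.
Qed.

(* Main.v *)
(** Upper bound (Galvin): a bipartite multigraph of maximum degree [d] has a
    proper coloring [phi] with [d] colors (König).  For an edge [e = xy], at
    most [d - 1 - phi e] edges at [x] have a larger color and at most [phi e]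
    edges at [y] have a smaller one.  So if "beats" means larger at [x] or
    smaller at [y], every edge is beaten by fewer than [d] others.  Given lists
    of size [d], pick a color [a] and give it to a stable matching of the edges
    whose list contains [a]; each of the other edges loses one list element and
    at least one of the edges beating it, so one can iterate.  Deleting the at
    most [2t] labels at the ends of an edge from [Delta + 2t] colors leaves
    [Delta] of them.

    Lower bound: label a vertex of maximum degree with [1..t] and all other
    vertices with [t+1..2t]; then the edges at that vertex need [Delta]
    distinct colors larger than [2t]. *)

Require Import Defs.
From mathcomp Require Import order boolp classical_sets functions cardinality.
From mathcomp Require Import all_boot perm.

Set Implicit Arguments.
Unset Strict Implicit.
Unset Printing Implicit Defensive.

(** * Counting by injections into intervals *)

Lemma card_le_interval (T : finType) (A : {set T}) (g : T -> nat) (lo hi : nat) :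
    {in A &, injective g} -> (forall z, z \in A -> lo <= g z < hi) ->
  #|A| <= hi - lo.
Proof.
move=> g_inj bnd; rewrite cardE -(size_map g) -(size_iota lo (hi - lo)).
apply: uniq_leq_size.
  by rewrite map_inj_in_uniq ?enum_uniq // => e f; rewrite !mem_enum; exact: g_inj.
move=> n /mapP[f]; rewrite mem_enum => /bnd /andP[lf fh] ->.
by rewrite mem_iota lf subnKC // ltnW // (leq_ltn_trans lf).
Qed.

(* A bipartite multigraph is given by two maps [x], [y] sending an edge to its
   end on either side; the sides are never compared, so they may share [V]. *)
Section BipartiteEdgeColoring.
Variables (E : finType) (V : eqType) (x y : E -> V).
Implicit Types (S T : {set E}) (e f g : E).

(** * Proper edge colorings: Kempe chains and König's theorem *)

Definition proper_on (K : Type) (S : {set E}) (phi : E -> K) : Prop :=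
  forall e f, e \in S -> f \in S -> x e = x f \/ y e = y f ->
    phi e = phi f -> e = f.

(* Color [e0] with [a], which is correct at [x e0], and exchange [a] and [b] on
   the Kempe chain that leaves [e0] through [x e0].  The chain is traversed in a
   fixed direction ([a]-edges are left through their [x]-end, [b]-edges through
   their [y]-end), so it could only come back to [y e0] along a
   [b]-edge, and there is none. *)
Lemma kempe_swap (K : finType) (S : {set E}) (e0 : E) (a b : K) (phi : E -> K) :
    e0 \notin S -> proper_on S phi ->
    (forall f, f \in S -> x f = x e0 -> phi f <> a) ->
    (forall f, f \in S -> y f = y e0 -> phi f <> b) ->
  exists psi : E -> K, proper_on (e0 |: S) psi.
Proof.
move=> e0S prop xa yb.
pose phi1 e := if e == e0 then a else phi e.
have phi1S e : e \in S -> phi1 e = phi e.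
  by rewrite /phi1; case: eqP => // -> ; rewrite (negPf e0S).
have phi10 : phi1 e0 = a by rewrite /phi1 eqxx.
have inS e : e \in e0 |: S -> e != e0 -> e \in S by rewrite !inE; case: (e == e0).
have px e f : e \in e0 |: S -> f \in e0 |: S -> x e = x f -> phi1 e = phi1 f -> e = f.
  move=> /setU1P[->|eS] /setU1P[->|fS] // xef; rewrite ?phi10 ?phi1S //.
  - by move=> /esym /xa; case.
  - by move=> /xa; case.
  - by apply: prop => //; left.
have py e f : e \in S -> f \in S -> y e = y f -> phi1 e = phi1 f -> e = f.
  by move=> eS fS yef; rewrite !phi1S //; apply: prop => //; right.
have yb1 f : f \in e0 |: S -> y f = y e0 -> a != b -> phi1 f <> b.
  by move=> /setU1P[->|fS] yf /eqP ab; rewrite ?phi10 ?phi1S //; exact: yb.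
have [ab|ab] := eqVneq a b.
  exists phi1 => e f eS fS [xef|yef]; first exact: px.
  move: eS fS yef => /setU1P[->|eS] /setU1P[->|fS] yef //.
  - by rewrite phi10 phi1S // => /esym; rewrite ab => /yb; case.
  - by rewrite phi10 phi1S // ab => /yb; case.
  - exact: py.
pose r e f := (f \in e0 |: S) &&
  ([&& phi1 e == a, phi1 f == b & x e == x f] ||
   [&& phi1 e == b, phi1 f == a & y e == y f]).
pose C := [pred e | connect r e0 e].
have C0 : C e0 by exact: connect0.
have Cstep e f : C e -> r e f -> C f.
  by move=> Ce ref; apply: connect_trans Ce _; exact: connect1.
have Cpred f : C f -> f != e0 -> exists2 e, C e & r e f.
  move=> /connectP[p]; elim/last_ind: p => [|p g _] /=; first by move=> _ ->; rewrite eqxx.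
  rewrite rcons_path last_rcons => /andP[pp rg] -> _.
  by exists (last e0 p) => //; apply/connectP; exists p.
have CS e : C e -> e \in e0 |: S.
  move=> Ce; have [->|ne] := eqVneq e e0; first by rewrite setU11.
  by have [? _ /andP[]] := Cpred e Ce ne.
have nab : b != a by rewrite eq_sym.
have Cpredb f : C f -> phi1 f = b -> exists2 e, C e & phi1 e = a /\ x e = x f.
  move=> Cf fb; have [|e Ce] := Cpred f Cf.
    by apply: contra_eq_neq fb => ->; rewrite phi10.
  rewrite /r fb eqxx (negPf nab) andbF orbF => /and3P[_ /eqP ea /eqP xe].
  by exists e.
have Cpreda f : C f -> f != e0 -> phi1 f = a -> exists2 e, C e & phi1 e = b /\ y e = y f.
  move=> Cf f0 fa; have [e Ce] := Cpred f Cf f0.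
  rewrite /r fa eqxx (negPf ab) andbF /= => /and3P[_ /eqP ea /eqP xe].
  by exists e.
pose psi e := if C e then tperm a b (phi1 e) else phi1 e.
(* A recolored chain edge [e] cannot clash with [f] off the chain. Where the chain leaves [e], [f]
   would be a successor of [e]; where it enters, [f] would be the predecessor of [e], or a [b]-edge
   at [y e0] if [e] is [e0]. *)
have mixed e f : e \in e0 |: S -> f \in e0 |: S -> x e = x f \/ y e = y f ->
    C e -> ~~ C f -> tperm a b (phi1 e) <> phi1 f.
  move=> eS fS adj Ce /negP nCf.
  have f0 : f != e0 by apply: contra_notN nCf => /eqP ->.
  have fS' := inS f fS f0.
  case: tpermP => [ea|eb|/eqP ea /eqP eb] h; apply: nCf.
  - case: adj => [xef|yef].
      by apply: (Cstep e) => //; rewrite /r fS ea -h xef !eqxx.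
    have [e00|ne] := eqVneq e e0.
      by case: (yb1 f) => //; rewrite -yef e00.
    have [g Cg [gb yg]] := Cpreda e Ce ne ea.
    have g0 : g != e0 by apply: contra_eq_neq gb => ->; rewrite phi10.
    have <- // : g = f.
    by apply: py; rewrite ?gb ?yg //; apply: inS => //; exact: CS.
  - case: adj => [xef|yef].
      have [g Cg [ga xg]] := Cpredb e Ce eb.
      have <- // : g = f.
      by apply: px; rewrite ?ga ?xg //; exact: CS.
    by apply: (Cstep e) => //; rewrite /r fS eb -h yef !eqxx orbT.
  - have <- // : e = f.
    case: adj => [xef|yef]; first exact: px.
    have ne : e != e0 by apply: contraNneq ea => ->; rewrite phi10.
    by apply: py => //; exact: inS.
(* A further [a]-edge of the chain at [y e0] would have been entered from a [b]-edge there. *)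
have e0case f : f \in e0 |: S -> C f -> y e0 = y f -> phi1 f = a -> e0 = f.
  move=> fS Cf yf fa; apply/eqP; rewrite eq_sym; apply/negP => /negP f0.
  have [g Cg [gb yg]] := Cpreda f Cf f0 fa.
  by apply: (yb1 g) => //; [exact: CS|rewrite yg].
exists psi => e f eS fS adj; rewrite /psi.
case: ifPn => Ce; case: ifPn => Cf.
- move/perm_inj; case: adj => [|yef h]; first exact: px.
  have [e00|ne] := eqVneq e e0.
    by subst e; apply: e0case => //; rewrite -h phi10.
  have [f00|nf] := eqVneq f e0.
    by subst f; apply/esym/e0case => //; rewrite h phi10.
  by apply: py => //; exact: inS.
- by move/mixed; case.
- by move/esym/mixed; case=> //; case: adj; [left|right].
- case: adj => [|yef h]; first exact: px.
  by apply: py => //; apply: inS => //; [apply: contraNneq Ce|apply: contraNneq Cf] => ->.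
Qed.

Lemma free_color (K : finType) (S : {set E}) (phi : E -> K) :
  #|S| < #|K| -> exists a, forall f, f \in S -> phi f <> a.
Proof.
move=> SK; have /card_gt0P[a] : 0 < #|~: (phi @: S)|.
  by rewrite cardsCs setCK subn_gt0 (leq_ltn_trans (leq_imset_card _ _)).
by rewrite inE => /negP aS; exists a => f fS fa; apply: aS; rewrite -fa imset_f.
Qed.

(** Edges are inserted one at a time: the new edge itself counts towards the degrees, so a color is
    still free at each of its ends, and [kempe_swap] applies. *)
Lemma konig_edge_coloring (K : finType) (k0 : K) :
    (forall e, #|[set f | x f == x e]| <= #|K|) ->
    (forall e, #|[set f | y f == y e]| <= #|K|) ->
  exists phi : E -> K, proper_on [set: E] phi.
Proof.
move=> dx dy.
suff /(_ #|E| [set: E])[|phi] : forall n S, #|S| = n -> exists phi : E -> K, proper_on S phi.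
- by rewrite cardsT.
- by exists phi.
elim=> [|n IHn] S Sn.
  by exists (fun=> k0) => e f; rewrite (cards0_eq Sn) inE.
have /card_gt0P[e0 e0S] : 0 < #|S| by rewrite Sn.
have [|phi phiP] := IHn (S :\ e0); first by move: Sn; rewrite (cardsD1 e0) e0S => -[].
have free (z : E -> V) : #|[set f | z f == z e0]| <= #|K| ->
    exists a, forall f, f \in S :\ e0 -> z f = z e0 -> phi f <> a.
  move=> dz; have [|a aP] := @free_color K [set f in S :\ e0 | z f == z e0] phi.
    apply: leq_trans dz; apply/proper_card/properP; split.
      by apply/subsetP => f; rewrite !inE => /andP[].
    by exists e0; rewrite !inE ?eqxx.
  by exists a => f fS zf; apply: aP; rewrite inE fS zf eqxx.
have [a aP] := free x (dx e0); have [b bP] := free y (dy e0).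
rewrite -(setD1K e0S); apply: (@kempe_swap K _ e0 a b phi) => //.
by rewrite !inE eqxx.
Qed.

(** * Stable matchings and Galvin's list coloring *)

Section StableMatching.
Variable rank : E -> nat.

Definition beats e f :=
  (x e == x f) && (rank f < rank e) || (y e == y f) && (rank e < rank f).

(* Keep the top edge at each [x]-end; if two of these meet at a [y]-end, the one
   of larger rank can be deleted from [T], by induction. *)
Lemma stable_matching (T : {set E}) :
    proper_on T rank ->
  exists K : {set E}, [/\ K \subset T,
    forall e f, e \in K -> f \in K -> x e = x f \/ y e = y f -> e = f &
    forall f, f \in T -> f \notin K -> exists2 e, e \in K & beats e f].
Proof.
move: {2}#|T| (erefl #|T|) => n; elim: n => [|n IHn] in T *.
  move=> T0 _; exists set0; split; first exact: sub0set.
    by move=> e f; rewrite inE.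
  by move=> f; rewrite (cards0_eq T0) inE.
move=> Tn prop.
pose P := [set e in T | [forall f in T, (x f == x e) ==> (rank f <= rank e)]].
have topP e f : e \in P -> f \in T -> x f = x e -> rank f <= rank e.
  rewrite inE => /andP[_ /forall_inP eP] fT xf.
  by have /implyP := eP f fT; apply; rewrite xf.
have PT e : e \in P -> e \in T by rewrite inE => /andP[].
have [/existsP[e /existsP[f /and4P[eP fP /eqP yef rk]]]|noconf] :=
  boolP [exists e, exists f, [&& e \in P, f \in P, y e == y f & rank e < rank f]].
  have fT := PT f fP; have eT := PT e eP.
  have [||K [KT Kind Kdom]] := IHn (T :\ f).
  - by move: Tn; rewrite (cardsD1 f) fT => -[].
  - by move=> g h /setD1P[_ gT] /setD1P[_ hT]; exact: prop.
  - exists K; split=> // [|g gT gK].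
      by apply: subset_trans KT _; exact: subsetDl.
    have [gf|gf] := eqVneq g f; last by apply: Kdom => //; rewrite !inE gf.
    rewrite gf; have [eK|eK] := boolP (e \in K).
      by exists e => //; rewrite /beats yef eqxx rk orbT.
    (* Since [e] is top at its [x]-end, the edge [h] beating it meets it at the [y]-end with smaller
       rank, hence beats [f] too. *)
    have [|h hK] := Kdom e _ eK.
      by rewrite !inE eT andbT; apply: contraTneq rk => ->; rewrite ltnn.
    have hT : h \in T by move/subsetP: KT => /(_ h hK) /setD1P[].
    case/orP => /andP[/eqP h1 h2].
      by move: h2; rewrite ltnNge (topP e h).
    by exists h => //; rewrite /beats h1 yef eqxx (ltn_trans h2 rk) orbT.
(* Without such a conflict, edges of [P] with a common [y]-end have equal rank, so they coincide. *)
have yinj e f : e \in P -> f \in P -> y e = y f -> rank f <= rank e.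
  move=> eP fP yef; rewrite leqNgt; apply: contra noconf => rk.
  by apply/existsP; exists e; apply/existsP; exists f; rewrite eP fP yef eqxx.
exists P; split; first by apply/subsetP.
- move=> e f eP fP adj; apply: (prop) => //; try exact: PT.
  apply/eqP; rewrite eqn_leq; case: adj => [xef|yef].
    by rewrite !topP //; exact: PT.
  by rewrite !yinj.
- move=> f fT fP.
  have [|e /andP[eT /eqP xe] emax] := @arg_maxnP _ f [pred e in T | x e == x f] rank.
    by rewrite /= fT eqxx.
  have eP : e \in P.
    rewrite inE eT; apply/forall_inP => g gT; apply/implyP => /eqP xg.
    by apply: emax; rewrite /= gT xg xe eqxx.
  have fe : rank f <= rank e by apply: emax; rewrite /= fT eqxx.
  exists e => //; rewrite /beats xe eqxx ltn_neqAle fe andbT.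
  apply/orP; left; apply/eqP => rk.
  by move: fP; rewrite (prop f e) ?eP //; left.
Qed.

Lemma galvin_list_coloring (K : finType) (k0 : K) (S : {set E}) (L : E -> {set K}) :
    proper_on S rank ->
    (forall e, e \in S -> #|[set f in S | beats f e]| < #|L e|) ->
  exists phi : E -> K, proper_on S phi /\ forall e, e \in S -> phi e \in L e.
Proof.
move: {2}#|S| (leqnn #|S|) => n; elim: n => [|n IHn] in S L *.
  rewrite leqn0 cards_eq0 => /eqP -> _ _.
  by exists (fun=> k0); split=> e; rewrite inE.
move=> Sn prop big.
have [->|[e1 e1S]] := set_0Vmem S.
  by exists (fun=> k0); split=> e; rewrite inE.
have /card_gt0P[a aL] : 0 < #|L e1| by apply: leq_ltn_trans (big e1 e1S).
pose T := [set e in S | a \in L e].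
have TS e : e \in T -> e \in S by rewrite inE => /andP[].
have [|M [/subsetP MT Mind Mdom]] := @stable_matching T.
  by move=> e f /TS eS /TS fS; exact: prop.
have MS e : e \in M -> e \in S by move=> /MT /TS.
(* The edge [e1] lies in [T], so it is in [M] or beaten from [M]; hence [S] really shrinks. *)
have /card_gt0P[m mM] : 0 < #|M|.
  rewrite lt0n cards_eq0; apply/eqP => M0.
  have e1T : e1 \in T by rewrite inE e1S.
  by have [|e] := Mdom e1 e1T; rewrite M0 inE.
have [||e|phi [phiP phiL]] := IHn (S :\: M) (fun e => L e :\ a).
- rewrite -ltnS; apply: leq_trans Sn; apply/proper_card/properP; split.
    exact: subsetDl.
  by exists m; [exact: MS|rewrite inE mM].
- by move=> e f /setDP[eS _] /setDP[fS _]; exact: prop.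
- move=> /setDP[eS eM]; have [aLe|aLe] := boolP (a \in L e).
    have [|h hM hbe] := Mdom e _ eM; first by rewrite inE eS.
    (* The successor is read as [(a \in L e) + _], so that [cardsD1] restores [#|L e|]. *)
    rewrite -ltnS -[(#|L e :\ a|).+1]/(true + _) -aLe -cardsD1.
    apply: leq_trans (big e eS); rewrite ltnS; apply/proper_card/properP; split.
      by apply/subsetP => g; rewrite !inE -andbA => /and3P[_ -> ->].
    by exists h; rewrite !inE ?hM ?MS.
  have -> : L e :\ a = L e.
    by apply/setP => k; rewrite !inE; case: eqP => // ->; rewrite (negPf aLe).
  apply: leq_ltn_trans (big e eS); apply/subset_leq_card/subsetP => g.
  by rewrite !inE -andbA => /and3P[_ -> ->].
exists (fun e => if e \in M then a else phi e); split=> [e f eS fS adj|e eS].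
  case: ifPn => eM; case: ifPn => fM h; first exact: Mind.
  - by have := phiL f; rewrite !inE fM fS -h eqxx => /(_ isT).
  - by have := phiL e; rewrite !inE eM eS h eqxx => /(_ isT).
  - by apply: phiP => //; rewrite inE ?eM ?fM.
case: ifPn => eM; first by have := MT e eM; rewrite inE => /andP[].
by have := phiL e; rewrite !inE eM eS => /(_ isT) /andP[].
Qed.

End StableMatching.

Theorem galvin (K : finType) (k0 : K) (d : nat) (L : E -> {set K}) :
    (forall e, #|[set f | x f == x e]| <= d) ->
    (forall e, #|[set f | y f == y e]| <= d) ->
    (forall e, d <= #|L e|) ->
  exists phi : E -> K, proper_on [set: E] phi /\ forall e, phi e \in L e.
Proof.
case: d => [|d] dx dy dL.
  have noE (e : E) : False.
    by have := dx e; rewrite leqn0 cards_eq0 => /eqP/setP/(_ e); rewrite !inE eqxx.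
  by exists (fun=> k0); split=> e; case: (noE e).
have [||phi phiP] := @konig_edge_coloring 'I_d.+1 ord0; rewrite ?card_ord //.
have [||psi [psiP psiL]] := @galvin_list_coloring (fun e => phi e) K k0 [set: E] L.
- by move=> e f eS fS adj /val_inj; exact: phiP.
- move=> e _; apply: leq_trans (dL e).
  have sub : [set f in [set: E] | beats (fun e => phi e) f e] \subset
     [set f | (x f == x e) && (phi e < phi f)] :|: [set f | (y f == y e) && (phi f < phi e)].
    by apply/subsetP => f; rewrite !inE /beats.
  (* The degree bound is now [d.+1]: at most [d - phi e] edges beat [e] at [x e] and at most [phi e]
     at [y e], together at most [d]. *)
  have cx : #|[set f | (x f == x e) && (phi e < phi f)]| <= d.+1 - (phi e).+1.
    apply: (@card_le_interval _ _ (fun f => phi f)) => [f g|f]; rewrite !inE.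
      move=> /andP[/eqP xf _] /andP[/eqP xg _] /val_inj.
      by apply: phiP; rewrite ?inE //; left; rewrite xf.
    by move=> /andP[_ ->] /=.
  have cy : #|[set f | (y f == y e) && (phi f < phi e)]| <= phi e - 0.
    apply: (@card_le_interval _ _ (fun f => phi f)) => [f g|f]; rewrite !inE.
      move=> /andP[/eqP yf _] /andP[/eqP yg _] /val_inj.
      by apply: phiP; rewrite ?inE //; right; rewrite yf.
    by move=> /andP[_ ->].
  rewrite ltnS; apply: leq_trans (subset_leq_card sub) _.
  apply: leq_trans (leq_card_setU _ _) _; apply: leq_trans (leq_add cx cy) _.
  by rewrite subn0 subSS subnK // -ltnS.
by exists psi; split=> // e; apply: psiL; rewrite inE.
Qed.

End BipartiteEdgeColoring.

(** * Extrema of sets of naturals and sizes of label sets *)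

Local Open Scope classical_set_scope.
Local Open Scope card_scope.

Lemma nat_min_unique (A : set nat) (n : nat) : A n -> lbound A n -> nat_min A = n.
Proof.
move=> An ln; apply: xget_unique => // m [Am lm].
by apply: anti_leq; apply/andP; split; [exact: lm|exact: ln].
Qed.

Lemma nat_max_unique (A : set nat) (n : nat) : A n -> ubound A n -> nat_max A = n.
Proof.
move=> An un; apply: xget_unique => // m [Am um].
by apply: anti_leq; apply/andP; split; [exact: un|exact: um].
Qed.

Lemma card_ord_set_le (A : set nat) (n t : nat) (D : {set 'I_n}) :
  A #<= `I_t -> (forall k : 'I_n, k \in D -> A k.+1) -> #|D| <= t.
Proof.
move=> /pcard_leP[g] DA; rewrite -(subn0 t).
apply: (@card_le_interval _ _ (fun k : 'I_n => g k.+1)) => [k l kD lD gkl|k kD].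
  apply/val_inj/succn_inj; apply: (@inj _ _ _ g) => //; apply: mem_set; exact: DA.
exact: (@funS _ _ _ _ g _ (DA k kD)).
Qed.

(** * Degree bounds and avoiding colorings of multigraphs *)

Section Multigraph.
Variable B : multigraph.
Implicit Types (e f : edge B) (v : vertex B) (c : vertex B -> set nat).

(** Source of both lower bounds: [k = 0] for the chromatic index, [k = 2 * t] for the avoiding
    one. *)
Lemma edge_coloring_degree (m k : nat) (c' : edge B -> nat) (v : vertex B) :
    edge_coloring m c' -> (forall e, v \in ends e -> k < c' e) ->
  degree v <= m - k.
Proof.
move=> [cm cP] kc; rewrite -subSS.
apply: (@card_le_interval _ _ c') => [e f|e]; rewrite !inE.
  move=> ve vf cef; apply/eqP; apply/negP => /negP ef.
  exact: cP ef ve vf cef.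
by move=> /kc ->; have /andP[_] := cm e.
Qed.

Lemma max_degree_gt0 : 0 < #|edge B| -> 0 < max_degree B.
Proof.
move=> /card_gt0P[e _]; have /card_gt0P[v ve] : 0 < #|ends e| by rewrite card_ends.
apply: leq_trans (leq_bigmax v); apply/card_gt0P; exists e.
by rewrite inE.
Qed.

(** Besides the upper bound for all labelings, empty labels with [t = 0] give that the chromatic
    index is at most the maximum degree. *)
Lemma avoiding_coloring c (t : nat) :
    bipartite B -> 0 < #|edge B| -> (forall v, c v #<= `I_t) ->
  exists c' : edge B -> nat, edge_coloring (max_degree B + 2 * t) c' /\ avoids c c'.
Proof.
move=> [X [Y [_ XY /choice[x /choice[y xyP]]]]] E0 ct.
have ends_xy e : ends e = [set x e; y e]%SET by case: (xyP e).
have degree_le v : degree v <= max_degree B by exact: leq_bigmax.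
have xd e : #|[set f | x f == x e]%SET| <= max_degree B.
  apply: leq_trans (degree_le (x e)); apply/subset_leq_card/subsetP => f.
  by rewrite !inE ends_xy !inE eq_sym => ->.
have yd e : #|[set f | y f == y e]%SET| <= max_degree B.
  apply: leq_trans (degree_le (y e)); apply/subset_leq_card/subsetP => f.
  by rewrite !inE ends_xy !inE eq_sym orbC => ->.
pose K := 'I_(max_degree B + 2 * t).
(* An ordinal [k] stands for the positive color [k.+1]. *)
pose bad v : {set K} := [set k : K | `[< c v k.+1 >]]%SET.
have bad_le v : #|bad v| <= t.
  by apply: (card_ord_set_le (ct v)) => k; rewrite inE => /asboolP.
pose L e := (~: (bad (x e) :|: bad (y e)))%SET.
have k0 : K by exists 0; rewrite addn_gt0 max_degree_gt0.
have [//|//|e|phi [phiP phiL]] := @galvin _ _ x y K k0 (max_degree B) L.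
  have L_bad : #|bad (x e) :|: bad (y e)| <= 2 * t.
    apply: leq_trans (leq_card_setU _ _) _.
    by apply: leq_trans (leq_add (bad_le _) (bad_le _)) _; rewrite addnn mul2n.
  rewrite cardsCs setCK card_ord leq_subRL; first by rewrite addnC leq_add2l.
  exact: leq_trans L_bad (leq_addl _ _).
exists (fun e => (phi e).+1); split; first split.
- by move=> e; rewrite /= ltn_ord.
- move=> e f v /eqP ef ve vf [/val_inj cef]; apply: ef.
  apply: phiP; rewrite ?inE //.
  (* The sides are disjoint, so a common end of two edges is the [x]-end of both or the [y]-end of
     both. *)
  have xNy e1 e2 : x e1 <> y e2.
    case: (xyP e1) (xyP e2) => xX _ _ [_ yY _] xy.
    by move/setP: XY => /(_ (x e1)); rewrite !inE xX xy yY.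
  move: ve vf; rewrite !ends_xy !inE => /orP[] /eqP -> /orP[] /eqP; auto.
    by move/xNy.
  by move/esym/xNy.
- move=> e [v /=]; rewrite ends_xy !inE => ve cv.
  have := phiL e; rewrite !inE negb_or => /andP[/asboolP ncx /asboolP ncy].
  by case/orP: ve => /eqP vE; subst v.
Qed.

End Multigraph.

(** * Evaluation of the two indices *)

Theorem theorem2p4 (B : multigraph) (hB : bipartite B)
    (hE : 0 < #|edge B|) (t : nat) :
  t_avoiding_chromatic_index B t = chromatic_index B + 2 * t /\
  chromatic_index B + 2 * t = max_degree B + 2 * t.
Proof.
have [|v vmax] := @eq_bigmax _ (@degree B).
  have /card_gt0P[e _] := hE.
  have /card_gt0P[v _] : 0 < #|ends e| by rewrite card_ends.
  by apply/card_gt0P; exists v.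
rewrite -/(max_degree B) in vmax.
have D0 := max_degree_gt0 hE.
have chiE : chromatic_index B = max_degree B.
  apply: nat_min_unique => [|m [_ [c' mc']]].
    split=> //; have [|c' [mc' _]] := @avoiding_coloring B (fun=> classical_sets.set0) 0 hB hE.
      by move=> w; rewrite card_ge0.
    by exists c'; move: mc'; rewrite muln0 addn0.
  rewrite vmax -[m]subn0; apply: (edge_coloring_degree mc') => e _.
  by case: mc' => /(_ e)/andP[].
rewrite chiE; split=> //; apply: nat_max_unique; last first.
  move=> _ [c [_ ct] <-].
  have ex := avoiding_coloring hB hE ct.
  have [|_] := @nat_minP [set m | 1 <= m /\
    exists c' : edge B -> nat, edge_coloring m c' /\ avoids c c'].
    by exists (max_degree B + 2 * t); split=> //=; rewrite addn_gt0 D0.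
  by apply; split=> //=; rewrite addn_gt0 D0.
(* [shift a] is the interval from [a + 1] to [a + t]. *)
pose shift a := (fun i => a + i.+1) @` `I_t.
pose c w : set nat := if w == v then shift 0 else shift t.
have ct w : c w #<= `I_t by rewrite /c; case: ifP => _; exact: card_image_le.
exists c.
  by split=> // w k; rewrite /c; case: ifP => _ [i _ <-] /=; rewrite addnS.
apply: nat_min_unique => [|m [_ [c' [mc' av]]]].
  split; first by rewrite addn_gt0 D0.
  exact: avoiding_coloring.
suff h e : v \in ends e -> 2 * t < c' e.
  have := edge_coloring_degree mc' h; rewrite -vmax.
  (* Any edge at [v] has a color above [2 * t]; this lets the truncated subtraction [m - 2 * t] be
     undone. *)
  have mt : 2 * t < m.
    have /card_gt0P[e] : 0 < degree v by rewrite -vmax.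
    by rewrite inE => /h /leq_trans; apply; case: mc' => /(_ e) /andP[].
  by rewrite leq_subRL 1?addnC // ltnW.
move=> ve; rewrite ltnNge; apply/negP => le2t.
have [w we wv] : exists2 w, w \in ends e & w != v.
  have /card_gt0P[w] : 0 < #|ends e :\ v|.
    by have := card_ends e; rewrite (cardsD1 v) ve add1n => -[->].
  by rewrite !inE => /andP[wv we]; exists w.
have c1 : 1 <= c' e by case: mc' => /(_ e)/andP[].
(* A color up to [t] is a label of [v]; one from [t + 1] to [2 * t] is a label of the other end
   [w]. *)
apply: (av e); have [le_t|lt_t] := leqP (c' e) t.
  exists v => //; rewrite /c eqxx; exists (c' e).-1; last by rewrite prednK.
  by rewrite /= prednK.
exists w => //; rewrite /c (negPf wv); exists (c' e - t).-1 => /=.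
  by rewrite prednK ?subn_gt0 // leq_subLR addnn -mul2n.
by rewrite prednK ?subn_gt0 // subnKC // ltnW.
Qed.
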